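(* The group $\tilde G=\langle a,\tilde b,\tilde c,\tilde d\rangle$ is just-infinite.
   Context: Let $\mathcal T_2=\{0,1\}^*$ be the binary rooted tree; automorphisms act on the left on finite words. For a letter $x$ let $\overline x=x+1\bmod 2$. The automorphism $a$ is given by $a(x\sigma)=\overline x\sigma$. The automorphisms $\tilde b,\tilde c,\tilde d$ are defined recursively (all fixing both vertices of the first level) by $\tilde b(0x\sigma)=0\overline x\sigma$, $\tilde b(1\sigma)=1\tilde c(\sigma)$; $\tilde c(0\sigma)=0\sigma$, $\tilde c(1\sigma)=1\tilde d(\sigma)$; $\tilde d(0\sigma)=0\sigma$, $\tilde d(1\sigma)=1\tilde b(\sigma)$. $\tilde G$ is the subgroup of $\operatorname{Aut}(\mathcal T_2)$ generated by $a,\tilde b,\tilde c,\tilde d$. A group is just-infinite if it is infinite and all its quotients by non-trivial normal subgroups are finite. *)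

(* Defs.v *)
From HB Require Import structures.
From mathcomp Require Import all_boot.
From mathcomp Require Import boolp classical_sets functions cardinality.

Set Implicit Arguments.
Unset Strict Implicit.
Unset Printing Implicit Defensive.

Local Open Scope classical_set_scope.
Local Open Scope group_scope.

(** * Subgroups and quotients of possibly infinite groups *)

Section Groups.
Variable G : groupType.
Implicit Types (A H N : set G) (x g : G).

Definition is_subgroup H := group_closed (mem H).

Definition is_normal_subgroup N :=
  is_subgroup N /\ forall x g, N x -> N (x ^ g).

Definition subgroup_gen A : set G :=
  \bigcap_(H in [set H | is_subgroup H /\ A `<=` H]) H.

(* The underlying set of the quotient group G / N. *)
Definition left_cosets N : set (set G) :=
  range (fun g => [set g * x | x in N]).

Lemma subgroup_gen_closed A : group_closed (mem (subgroup_gen A)).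
Proof.
split; first by rewrite inE => H [[H1 _] _]; rewrite inE in H1.
move=> x y; rewrite !inE => Ax Ay H [HH AH].
by have := HH.2 x y; rewrite !inE; apply; [apply: Ax | apply: Ay].
Qed.

Definition gen_group A := {x : G | x \in subgroup_gen A}.

HB.instance Definition _ A := SubChoice.on (gen_group A).
HB.instance Definition _ A := SubChoice_isSubGroup.Build G
  (fun x => x \in subgroup_gen A) (gen_group A) (subgroup_gen_closed A).

End Groups.

Definition just_infinite (G : groupType) :=
  infinite_set [set: G] /\
  forall N : set G, is_normal_subgroup N -> N <> [set 1] ->
    finite_set (left_cosets N).

(** * The binary rooted tree and its automorphism group *)

(* Vertices are the finite words over {0,1}, with 0 = false and 1 = true;
   the root is the empty word. *)
Notation word := (seq bool).

Definition child (u v : word) := exists x, v = rcons u x.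

Definition adjacent (u v : word) := child u v \/ child v u.

Record tree_aut := TreeAut {
  taut_fun :> word -> word;
  taut_inv : word -> word;
  taut_funK : cancel taut_fun taut_inv;
  taut_invK : cancel taut_inv taut_fun;
  taut_root : taut_fun [::] = [::];
  taut_adj : forall u v, adjacent (taut_fun u) (taut_fun v) <-> adjacent u v
}.

Lemma tree_autP (f g : tree_aut) : f =1 g -> f = g.
Proof.
case: f g => [f f' fK f'K f0 fA] [g g' gK g'K g0 gA] /= /funext fg.
move: fK f'K f0 fA; rewrite fg => fK f'K f0 fA.
have e : f' = g' by apply/funext => w; rewrite -{1}(g'K w) fK.
move: fK f'K; rewrite e => fK f'K.
by congr TreeAut; apply: Prop_irrelevance.
Qed.

HB.instance Definition _ := gen_eqMixin tree_aut.
HB.instance Definition _ := gen_choiceMixin tree_aut.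

Definition taut_id : tree_aut.
Proof. by exists id id. Defined.

(* Automorphisms act on the left: f * g is "g first, then f". *)
Definition taut_comp (f g : tree_aut) : tree_aut.
Proof.
exists (f \o g) (taut_inv g \o taut_inv f).
- exact: can_comp (taut_funK f) (taut_funK g).
- exact: can_comp (taut_invK g) (taut_invK f).
- by rewrite /= !taut_root.
- by move=> u v; rewrite /= !taut_adj.
Defined.

Definition taut_inverse (f : tree_aut) : tree_aut.
Proof.
exists (taut_inv f) f.
- exact: taut_invK.
- exact: taut_funK.
- by rewrite -{1}(taut_root f) taut_funK.
- by move=> u v; rewrite -(taut_adj f) !taut_invK.
Defined.

Lemma taut_compA : associative taut_comp.
Proof. by move=> f g h; apply: tree_autP. Qed.
Lemma taut_comp1 : left_id taut_id taut_comp.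
Proof. by move=> f; apply: tree_autP. Qed.
Lemma taut_compx1 : right_id taut_id taut_comp.
Proof. by move=> f; apply: tree_autP. Qed.
Lemma taut_compV : left_inverse taut_id taut_inverse taut_comp.
Proof. by move=> f; apply: tree_autP => w /=; rewrite taut_funK. Qed.
Lemma taut_compxV : right_inverse taut_id taut_inverse taut_comp.
Proof. by move=> f; apply: tree_autP => w /=; rewrite taut_invK. Qed.

HB.instance Definition _ := isGroup.Build tree_aut
  taut_compA taut_comp1 taut_compx1 taut_compV taut_compxV.

Lemma taut_mulE (f g : tree_aut) (w : word) : (f * g) w = f (g w).
Proof. by []. Qed.

(** * The generators *)

Definition a_fun (w : word) : word :=
  if w is x :: s then ~~ x :: s else [::].

Fixpoint b_fun (w : word) : word :=
  match w with
  | false :: x :: s => [:: false, ~~ x & s]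
  | true :: s => true :: c_fun s
  | _ => w
  end
with c_fun (w : word) : word :=
  if w is true :: s then true :: d_fun s else w
with d_fun (w : word) : word :=
  if w is true :: s then true :: b_fun s else w.

Lemma a_funK : involutive a_fun.
Proof. by case=> //= x s; rewrite negbK. Qed.

Lemma bcd_funK w :
  [/\ b_fun (b_fun w) = w, c_fun (c_fun w) = w & d_fun (d_fun w) = w].
Proof.
elim: w => [|[] s [bK cK dK]] //=; first by rewrite bK cK dK.
by case: s {bK cK dK} => [|x s] //=; rewrite negbK.
Qed.

Lemma a_fun_child u v : child u v -> child (a_fun u) (a_fun v).
Proof.
by case=> x ->; case: u => [|y s] /=; [exists (~~ x) | exists x].
Qed.

Lemma bcd_fun_child w x :
  [/\ child (b_fun w) (b_fun (rcons w x)),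
      child (c_fun w) (c_fun (rcons w x)) &
      child (d_fun w) (d_fun (rcons w x))].
Proof.
elim: w => [|[] s [[y bE] [z cE] [t dE]]].
- by case: x; split; eexists; rewrite /= -?cats1.
- by split=> /=; [exists z; rewrite cE | exists t; rewrite dE |
    exists y; rewrite bE].
- split; [|by exists x|by exists x].
  by case: s {bE cE dE} => [|z' s]; [exists (~~ x) | exists x].
Qed.

Lemma involutive_adj (f : word -> word) : involutive f ->
  (forall u v, child u v -> child (f u) (f v)) ->
  forall u v, adjacent (f u) (f v) <-> adjacent u v.
Proof.
move=> fK fC u v; split; last by case=> /fC; [left | right].
by case=> /fC; rewrite !fK; [left | right].
Qed.

Definition involution_aut (f : word -> word) (fK : involutive f)
    (f0 : f [::] = [::])
    (fC : forall u v, child u v -> child (f u) (f v)) : tree_aut :=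
  TreeAut fK fK f0 (involutive_adj fK fC).

Lemma b_funK : involutive b_fun. Proof. by move=> w; case: (bcd_funK w). Qed.
Lemma c_funK : involutive c_fun. Proof. by move=> w; case: (bcd_funK w). Qed.
Lemma d_funK : involutive d_fun. Proof. by move=> w; case: (bcd_funK w). Qed.

Lemma b_fun_child u v : child u v -> child (b_fun u) (b_fun v).
Proof. by case=> x ->; case: (bcd_fun_child u x). Qed.
Lemma c_fun_child u v : child u v -> child (c_fun u) (c_fun v).
Proof. by case=> x ->; case: (bcd_fun_child u x). Qed.
Lemma d_fun_child u v : child u v -> child (d_fun u) (d_fun v).
Proof. by case=> x ->; case: (bcd_fun_child u x). Qed.

Definition aut_a := involution_aut a_funK erefl a_fun_child.
Definition aut_b := involution_aut b_funK erefl b_fun_child.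
Definition aut_c := involution_aut c_funK erefl c_fun_child.
Definition aut_d := involution_aut d_funK erefl d_fun_child.

Definition Gtilde : groupType := gen_group [set aut_a; aut_b; aut_c; aut_d].

(* Main.v *)
From HB Require Import structures.
From Corelib Require Import Setoid Morphisms.
From mathcomp Require Import all_boot.
From mathcomp Require Import boolp classical_sets functions cardinality.
Require Import Defs.

Set Implicit Arguments.
Unset Strict Implicit.
Unset Printing Implicit Defensive.

Local Open Scope classical_set_scope.
Local Open Scope group_scope.

(** The group is regular branch. For [g] fixing the first level write
    [g = (g0, g1)] for its action on the two subtrees, so that [b = (a, c)],
    [c = (1, d)], [d = (1, b)], and conjugation by [a] swaps the coordinates.
    Let [K] be the normal closure of [x = [a, b]] and [y = [a, d]].

    - [K] contains [K x 1] ([branch]): modulo [K] the element [b] is centralised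
      by [a], [c], [d], hence also by the conjugates of [d] and [c] under [a],
      and the commutators of [b] with these are [(x, 1)] and [(y, 1)].

    - A nontrivial element [g] of a normal subgroup [N] moves some vertex [u]. If
      [p], [q] are copies of elements of [K] acting only below [u], then [p^-1 ^ g] acts only
      below another vertex of the same level, so commuting [p^-1] with [g] and
      the result with [q] gives [[p, q]] up to conjugation. Hence [N] contains
      a copy of the derived subgroup [K'] below [u] ([moved_finite_index]).

    - Let [left_rist N] be the normal subgroup of all [h] with [(h, 1)] in [N].
      Since [N] is normalised by [a], it contains the product
      [left_rist N x left_rist N], and therefore it has finite index as soon as
      [left_rist N] does ([left_rist_finite_index]). Descending along [u], it
      remains to treat normal subgroups [N] containing [K'].

    - As [x = (ca, ac)] and [y = (b, b)], commuting [(k, 1)] with [x] and [y]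
      shows that [left_rist N] contains [[k, ca]] and [[k, b]] for all [k] in
      [K]. A normal subgroup with this property has finite index
      ([central_mod_finite_index]): in the quotient [b] both inverts and
      centralises [x], so [x] is an involution; so are its conjugate under [d]
      and [y] (for which [y^2 = (b^2, b^2) = 1]), and every element of the
      quotient has one of 256 normal forms.

    The group is infinite because each [h] is the left section of some [f h]
    fixing the first level ([fractal]), and [f] is injective but misses [a]. *)

(** * Cosets of normal subgroups *)

Section NormalSubgroups.
Variables (G : groupType) (N : set G).
Hypothesis nN : is_normal_subgroup N.
Implicit Types g h k u v w r : G.

Lemma normal1 : N 1.
Proof. by have [[+ _] _] := nN; rewrite inE. Qed.

Lemma normal_div g h : N g -> N h -> N (g / h).
Proof. by have [[_ +] _] := nN => /(_ g h); rewrite !inE; apply. Qed.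

Lemma normalV g : N g -> N g^-1.
Proof. by move=> Ng; rewrite -[g^-1]mul1g; apply: normal_div; first exact: normal1. Qed.

Lemma normalM g h : N g -> N h -> N (g * h).
Proof. by move=> Ng Nh; rewrite -[h]invgK; apply: normal_div => //; apply: normalV. Qed.

Lemma normalJ g h : N g -> N (g ^ h).
Proof. by have [_ +] := nN; apply. Qed.

Lemma normalRl g h : N g -> N [~ g, h].
Proof. by move=> Ng; rewrite commgEl; apply: normalM; [apply: normalV | apply: normalJ]. Qed.

Lemma normalRr g h : N h -> N [~ g, h].
Proof. by move=> Nh; rewrite -invgR; apply: normalV; apply: normalRl. Qed.

Definition eqmod g h := N (g^-1 * h).

Lemma eqmod_refl g : eqmod g g.
Proof. by rewrite /eqmod mulVg; apply: normal1. Qed.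

Lemma eqmod_sym g h : eqmod g h -> eqmod h g.
Proof. by move=> /normalV; rewrite invgM invgK. Qed.

Lemma eqmod_trans g h k : eqmod g h -> eqmod h k -> eqmod g k.
Proof. by move=> gh /(normalM gh); rewrite /eqmod -mulgA mulVKg. Qed.

Lemma eqmodM g g' h h' : eqmod g g' -> eqmod h h' -> eqmod (g * h) (g' * h').
Proof.
move=> Egg Ehh; rewrite /eqmod.
have -> : (g * h)^-1 * (g' * h') = (g^-1 * g') ^ h * (h^-1 * h').
  by rewrite conjgE invgM -!mulgA mulVKg.
by apply: normalM => //; apply: normalJ.
Qed.

Definition commod g h := eqmod (g * h) (h * g).

Lemma commodP g h : commod g h <-> N [~ h, g].
Proof. by rewrite /commod /eqmod commgEl conjgE invgM !mulgA. Qed.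

End NormalSubgroups.

(** Finite index is expressed by finitely many colours separating the cosets:
    this form passes directly from sections of an element to the element. *)
Definition finite_index (G : groupType) (N : set G) :=
  exists (T : finType) (f : G -> T), forall g h, f g = f h -> eqmod N g h.

Lemma finite_left_cosets (G : groupType) (N : set G) :
  is_normal_subgroup N -> finite_index N -> finite_set (left_cosets N).
Proof.
move=> nN [T [f fP]].
pose coset_at (t : T) := [set g | forall h, f h = t -> eqmod N h g].
apply: (sub_finite_set _ (finite_image coset_at (@finite_finset T setT))).
move=> _ [g _ <-]; exists (f g) => //.
apply/seteqP; split=> [h /(_ g erefl) gh|_ [x Nx <-] h /fP].
- by exists (g^-1 * h) => //; rewrite mulVKg.
- by rewrite /eqmod mulgA => /(normalM nN); apply.
Qed.

(** * Normal forms modulo a normal subgroup *)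

Section NormalForm.
Variables (G : groupType) (N : set G).
Hypothesis nN : is_normal_subgroup N.
Local Notation "g =N h" := (eqmod N g h) (at level 70).

#[local] Instance eqmod_equiv : Equivalence (eqmod N).
Proof.
split; [exact: eqmod_refl | move=> g h; exact: eqmod_sym
  | move=> g h k; exact: eqmod_trans].
Qed.

#[local] Instance eqmod_proper :
  Proper (eqmod N ==> eqmod N ==> eqmod N) (@mul G).
Proof. by move=> g g' gg' h h' hh'; apply: eqmodM. Qed.

#[local] Hint Extern 0 (eqmod N _ _) => exact: (eqmod_refl nN) : core.

Lemma commod_refl g : commod N g g.
Proof. exact: eqmod_refl. Qed.

Lemma commod_sym g h : commod N g h -> commod N h g.
Proof. by rewrite /commod => gh; symmetry. Qed.

Lemma commod1 g : commod N g 1.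
Proof. rewrite /commod mulg1 mul1g; exact: eqmod_refl. Qed.

Lemma commodM g h k : commod N g h -> commod N g k -> commod N g (h * k).
Proof. by rewrite /commod => gh gk; rewrite mulgA gh -mulgA gk mulgA. Qed.

Lemma commute_commod g h : commute g h -> commod N g h.
Proof. by rewrite /commod => ->. Qed.

(** An element that is both inverted and centralised by [g] is an involution. *)
Lemma inverted_square g h : g * h = h^-1 * g -> commod N g h -> h * h =N 1.
Proof.
rewrite /commod => -> gh; rewrite -{2}(mulgK g h) -gh.
by rewrite mulgA mulgA mulgV mul1g mulgV.
Qed.

(** The assumption on [g * h] says that [t] is the commutator of [g] and [h]: the
    two copies of [t] produced when [g] passes both [h]'s cancel. *)
Lemma commod_twist g h k t : t * t = 1 -> commute h t ->
  g * h = t * (h * g) -> commod N g k -> commod N k t ->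
  commod N g (h * (k * h)).
Proof.
move=> tt ht gh; rewrite /commod => gk kt.
rewrite mulgA gh -!mulgA [g * (k * h)]mulgA gk -mulgA gh.
rewrite [k * (t * _)]mulgA kt -[t * k * _]mulgA [h * (t * _)]mulgA ht.
by rewrite -[t * h * _]mulgA [t * (t * _)]mulgA tt mul1g.
Qed.

Lemma commodX g h n : commod N g h -> commod N g (h ^+ n).
Proof.
by move=> gh; elim: n => [|n IH]; [apply: commod1 | rewrite expgS; apply: commodM].
Qed.

Lemma commodA g h k : commod N g h -> g * (h * k) =N h * (g * k).
Proof. by rewrite /commod !mulgA => ->. Qed.

Lemma involM_exp g (i : bool) h : g * g =N 1 -> g * (g ^+ i * h) =N g ^+ (~~ i) * h.
Proof. by case: i; rewrite !expgb ?mul1g // mulgA => ->; rewrite mul1g. Qed.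

(** Moves [h] past a power of [g] when [h] conjugates [g] to [g']. *)
Lemma swapX g g' h (i : bool) k :
  h * g =N g' * h -> h * (g ^+ i * k) =N g' ^+ i * (h * k).
Proof. by case: i; rewrite !expgb ?mul1g // !mulgA => ->. Qed.

Variables a b c d x x' y z : G.
Hypotheses (aa : a * a =N 1) (bb : b * b =N 1) (cc : c * c =N 1) (dd : d * d =N 1)
  (xx : x * x =N 1) (yy : y * y =N 1).
Hypotheses (ax : commod N a x) (ax' : commod N a x') (ay : commod N a y)
  (bx : commod N b x) (bx' : commod N b x') (by_ : commod N b y)
  (cx : commod N c x) (cx' : commod N c x') (cy : commod N c y)
  (dx : d * x =N x' * d) (dx' : d * x' =N x * d) (dy : commod N d y)
  (xx'C : commod N x x') (xy : commod N x y) (x'y : commod N x' y).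
Hypotheses (bd : commod N b d) (cb : commod N c b) (cd : commod N c d)
  (cz : commod N c z).
Hypotheses (ab : a * b =N x * (b * a)) (ad : a * d =N y * (d * a))
  (ac : a * c =N z * a) (az : a * z =N c * a).

(** In the application [x], [x' = x ^ d], [y] generate the image of [K], and [c],
    [z = c ^ a], [a] generate a dihedral group of order 8. *)
Definition nform (t : bool * bool * bool * bool * bool * bool * bool * bool) :=
  let: (i, j, k, l, m, p, q, e) := t in
  y ^+ i * (x ^+ j * (x' ^+ k * (b ^+ l * (d ^+ m *
    (c ^+ p * (z ^+ q * a ^+ e)))))).

(** Moving [a] to the right turns [b] into [x b] and [d] into [y d], and
    exchanges the commuting involutions [c] and [z]; the new factors [x] and [y]
    are then collected on the left. *)
Lemma nform_a t : exists t', a * nform t =N nform t'.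
Proof.
case: t => [[[[[[[i j] k] l] m] p] q] e].
exists (i (+) m, j (+) l, k, l, m, q, p, ~~ e) => /=.
rewrite (swapX _ _ ay) (swapX _ _ ax) (swapX _ _ ax').
have -> : forall r, a * (b ^+ l * r) =N x ^+ l * (b ^+ l * (a * r)).
  by move=> r; case: (l); rewrite !expgb ?mul1g // !mulgA ab !mulgA.
have -> : forall r, a * (d ^+ m * r) =N y ^+ m * (d ^+ m * (a * r)).
  by move=> r; case: (m); rewrite !expgb ?mul1g // !mulgA ad !mulgA.
rewrite (swapX _ _ ac) (swapX _ _ az).
have -> : a * a ^+ e =N a ^+ (~~ e).
  by rewrite -[a ^+ e]mulg1 involM_exp // mulg1.
have -> : forall r, z ^+ p * (c ^+ q * r) =N c ^+ q * (z ^+ p * r).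
  by move=> r; apply: commodA; apply/commodX/commod_sym/commodX.
have ymove v r : commod N v y -> v * (y ^+ m * r) =N y ^+ m * (v * r).
  by move=> vy; apply: commodA; apply: commodX.
have [bly xjy x'ky] : [/\ commod N (b ^+ l) y, commod N (x ^+ j) y & commod N (x' ^+ k) y].
  by split; apply/commod_sym/commodX/commod_sym.
have [xly yiy] : commod N (x ^+ l) y /\ commod N (y ^+ i) y.
  by split; apply/commod_sym/commodX; [apply: commod_sym | apply: commod_refl].
rewrite !ymove //.
have -> : forall r, x' ^+ k * (x ^+ l * r) =N x ^+ l * (x' ^+ k * r).
  by move=> r; apply: commodA; apply/commodX/commod_sym/commodX.
have mulX v (i1 i2 : bool) r : v * v =N 1 ->
    v ^+ i1 * (v ^+ i2 * r) =N v ^+ (i1 (+) i2) * r.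
  by move=> vv; case: i1; rewrite /= ?mul1g // expg1 involM_exp.
by rewrite !mulX // [m (+) i]addbC.
Qed.

Lemma nform_b t : exists t', b * nform t =N nform t'.
Proof.
case: t => [[[[[[[i j] k] l] m] p] q] e]; exists (i, j, k, ~~ l, m, p, q, e) => /=.
by rewrite (swapX _ _ by_) (swapX _ _ bx) (swapX _ _ bx') involM_exp.
Qed.

Lemma nform_c t : exists t', c * nform t =N nform t'.
Proof.
case: t => [[[[[[[i j] k] l] m] p] q] e]; exists (i, j, k, l, m, ~~ p, q, e) => /=.
by rewrite (swapX _ _ cy) (swapX _ _ cx) (swapX _ _ cx') (swapX _ _ cb)
   (swapX _ _ cd) involM_exp.
Qed.

Lemma nform_d t : exists t', d * nform t =N nform t'.
Proof.
case: t => [[[[[[[i j] k] l] m] p] q] e]; exists (i, k, j, l, ~~ m, p, q, e) => /=.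
rewrite (swapX _ _ dy) (swapX _ _ dx) (swapX _ _ dx') (swapX _ _ (commod_sym bd)).
rewrite involM_exp //.
have -> // : forall r, x' ^+ j * (x ^+ k * r) =N x ^+ k * (x' ^+ j * r).
by move=> r; apply: commodA; apply/commodX/commod_sym/commodX.
Qed.

(** The normal forms contain 1 and are stable under left multiplication by the
    generators, so they meet every coset; there are [2 ^ 8] of them. *)
Lemma nform_finite_index :
  (forall Q : G -> Prop, Q 1 ->
    (forall g, Q g -> [/\ Q (a * g), Q (b * g), Q (c * g) & Q (d * g)]) ->
    forall g, Q g) ->
  finite_index N.
Proof.
move=> gen.
have cover g : exists t, g =N nform t.
  elim/gen: g => [|g [t gt]].
    exists (false, false, false, false, false, false, false, false);
      by rewrite /= !expg0 !mul1g.
  have [[ta Ea] [tb Eb] [tc Ec] [td Ed]] :=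
    And4 (nform_a t) (nform_b t) (nform_c t) (nform_d t).
  by split; [exists ta | exists tb | exists tc | exists td]; rewrite gt.
have [f fP] := choice cover.
by exists _, f => g h fgh; rewrite (fP g) (fP h) fgh.
Qed.

End NormalForm.

(** * The generators *)

Definition act (g : Gtilde) : word -> word := val g.

Lemma actM g h w : act (g * h) w = act g (act h w).
Proof. by []. Qed.

Lemma act_ext g h : act g =1 act h -> g = h.
Proof. by move=> gh; apply: val_inj; apply: tree_autP. Qed.

Lemma actK g : cancel (act g) (act g^-1).
Proof. by move=> w; rewrite -actM mulVg. Qed.

Lemma actVK g : cancel (act g^-1) (act g).
Proof. by move=> w; rewrite -actM mulgV. Qed.

Lemma act_nil g : act g [::] = [::].
Proof. exact: taut_root. Qed.

Lemma mem_generator g : [set aut_a; aut_b; aut_c; aut_d] g ->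
  g \in subgroup_gen [set aut_a; aut_b; aut_c; aut_d].
Proof. by move=> gS; rewrite inE => H [_]; apply. Qed.

Definition genr g (gS : [set aut_a; aut_b; aut_c; aut_d] g) : Gtilde :=
  exist _ g (mem_generator gS).

Definition ta : Gtilde := genr (or_introl (or_introl (or_introl erefl))).
Definition tb : Gtilde := genr (or_introl (or_introl (or_intror erefl))).
Definition tc : Gtilde := genr (or_introl (or_intror erefl)).
Definition td : Gtilde := genr (or_intror erefl).

Lemma taa : ta * ta = 1. Proof. by apply: act_ext => w; exact: a_funK. Qed.

Lemma tbb : tb * tb = 1. Proof. by apply: act_ext => w; exact: b_funK. Qed.

Lemma tcc : tc * tc = 1. Proof. by apply: act_ext => w; exact: c_funK. Qed.

Lemma tdd : td * td = 1. Proof. by apply: act_ext => w; exact: d_funK. Qed.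

Lemma taV : ta^-1 = ta. Proof. exact: mulg1_eq taa. Qed.

Lemma tbV : tb^-1 = tb. Proof. exact: mulg1_eq tbb. Qed.

Lemma tdV : td^-1 = td. Proof. exact: mulg1_eq tdd. Qed.

(** The elements whose left translation preserves and reflects [Q] form a
    subgroup, and it contains the generators since these are involutions. *)
Lemma Gtilde_ind (Q : Gtilde -> Prop) : Q 1 ->
  (forall g, Q g -> [/\ Q (ta * g), Q (tb * g), Q (tc * g) & Q (td * g)]) ->
  forall g, Q g.
Proof.
move=> Q1 QM g.
pose S := [set x | exists2 h : Gtilde, val h = x & forall k, Q k <-> Q (h * k)].
have involS t : t * t = 1 -> (forall k, Q k -> Q (t * k)) -> S (val t).
  move=> tt Qt; exists t => // k; split=> [|/Qt]; first exact: Qt.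
  by rewrite mulgA tt mul1g.
have [h /val_inj -> Qh] : S (val g); last by rewrite -[g]mulg1 -Qh.
have := valP g; rewrite inE; apply; split; first split.
- by rewrite inE; exists 1 => // k; rewrite mul1g.
- move=> u v; rewrite !inE => -[h <- Qh] [k <- Qk]; exists (h / k) => // m.
  by rewrite -mulgA -Qh (Qk (_ * m)) mulVKg.
- by move=> x [[[->|->]|->]|->]; [apply: (involS ta taa) | apply: (involS tb tbb)
    | apply: (involS tc tcc) | apply: (involS td tdd)] => k /QM[].
Qed.

(** * Sections on the first level *)

Definition decomp (g g0 g1 : Gtilde) := forall s,
  act g (false :: s) = false :: act g0 s /\ act g (true :: s) = true :: act g1 s.

Lemma decomp1 : decomp 1 1 1.
Proof. by []. Qed.

Lemma decompM g g0 g1 h h0 h1 : decomp g g0 g1 -> decomp h h0 h1 ->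
  decomp (g * h) (g0 * h0) (g1 * h1).
Proof.
move=> dg dh s; rewrite !actM.
by have [-> ->] := dh s; have [-> _] := dg (act h0 s); have [_ ->] := dg (act h1 s).
Qed.

Lemma decompV g g0 g1 : decomp g g0 g1 -> decomp g^-1 g0^-1 g1^-1.
Proof.
move=> dg s; split; apply: (can_inj (actK g)); rewrite actVK.
- by rewrite (dg _).1 actVK.
- by rewrite (dg _).2 actVK.
Qed.

Lemma decompJ g g0 g1 h h0 h1 : decomp g g0 g1 -> decomp h h0 h1 ->
  decomp (g ^ h) (g0 ^ h0) (g1 ^ h1).
Proof. by move=> dg dh; rewrite !conjgE; apply: decompM (decompV dh) (decompM dg dh). Qed.

Lemma decompR g g0 g1 h h0 h1 : decomp g g0 g1 -> decomp h h0 h1 ->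
  decomp [~ g, h] [~ g0, h0] [~ g1, h1].
Proof. by move=> dg dh; rewrite !commgEl; apply: decompM (decompV dg) (decompJ dg dh). Qed.

Lemma decompJa g g0 g1 : decomp g g0 g1 -> decomp (g ^ ta) g1 g0.
Proof.
by move=> dg s; rewrite conjgE taV !actM; have [-> ->] := dg s.
Qed.

Lemma decomp_b : decomp tb ta tc. Proof. by move=> [|x s]. Qed.

Lemma decomp_c : decomp tc 1 td. Proof. by []. Qed.

Lemma decomp_d : decomp td 1 tb. Proof. by []. Qed.

Lemma decomp_inj g h g0 g1 : decomp g g0 g1 -> decomp h g0 g1 -> g = h.
Proof.
move=> dg dh; apply: act_ext => -[|[] s]; first by rewrite !act_nil.
- by rewrite (dg s).2 (dh s).2.
- by rewrite (dg s).1 (dh s).1.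
Qed.

Lemma decomp_unique g g0 g1 h0 h1 : decomp g g0 g1 -> decomp g h0 h1 -> g0 = h0 /\ g1 = h1.
Proof.
move=> dg dh; split; apply: act_ext => s.
- by have := (dg s).1; rewrite (dh s).1 => -[].
- by have := (dg s).2; rewrite (dh s).2 => -[].
Qed.

Lemma decomp_exists g : exists (e : bool) g0 g1, decomp (ta ^+ e * g) g0 g1.
Proof.
have fixing t t0 t1 (e : bool) g0 g1 k : decomp t t0 t1 -> decomp (ta ^+ e * k) g0 g1 ->
    exists (e : bool) g0 g1, decomp (ta ^+ e * (t * k)) g0 g1.
  move=> dt dk; exists e.
  suff -> : ta ^+ e * (t * k) = t ^ (ta ^+ e) * (ta ^+ e * k).
    case: e dk => dk; last by exists (t0 * g0), (t1 * g1); apply: decompM dk.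
    by exists (t1 * g0), (t0 * g1); apply: decompM (decompJa dt) dk.
  case: (e); rewrite ?mul1g ?conjg1 // !expg1 conjgE taV -!mulgA.
  by rewrite [ta * (ta * k)]mulgA taa mul1g.
elim/Gtilde_ind: g => [|g [e [g0 [g1 dg]]]]; first by exists false, 1, 1.
split.
- exists (~~ e), g0, g1; suff -> : ta ^+ (~~ e) * (ta * g) = ta ^+ e * g by [].
  by case: (e); rewrite !expgb ?mul1g // mulgA taa mul1g.
- exact: fixing decomp_b dg.
- exact: fixing decomp_c dg.
- exact: fixing decomp_d dg.
Qed.

(** The left sections include [a] (of [b]) and [b], [c], [d] (of the conjugates
    by [a] of [d], [b], [c]), hence all elements. *)
Lemma fractal h : exists g g1, decomp g h g1.
Proof.
elim/Gtilde_ind: h => [|h [g [g1 dg]]]; first by exists 1, 1.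
split.
- by exists (tb * g), (tc * g1); apply: decompM decomp_b dg.
- by exists (td ^ ta * g), (1 * g1); apply: decompM (decompJa decomp_d) dg.
- by exists (tb ^ ta * g), (ta * g1); apply: decompM (decompJa decomp_b) dg.
- by exists (tc ^ ta * g), (1 * g1); apply: decompM (decompJa decomp_c) dg.
Qed.

(** * Elements supported on the left subtree *)

(** The rigid stabiliser in [N] of the left vertex, identified with its action
    on the left subtree. *)
Definition left_rist (N : set Gtilde) : set Gtilde :=
  [set h | exists2 g, N g & decomp g h 1].

(** By [fractal], conjugation by any [k] on the left coordinate is induced by
    conjugation by an element fixing the first level. *)
Lemma left_rist_normal N : is_normal_subgroup N -> is_normal_subgroup (left_rist N).
Proof.
move=> nN; split; first split.
- by rewrite inE; exists 1; [apply: normal1 | apply: decomp1].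
- move=> h k; rewrite !inE => -[g Ng dg] [f Nf df].
  exists (g / f); first exact: normal_div.
  by rewrite -[1](mulgV 1); apply: decompM dg (decompV df).
- move=> h k [g Ng dg]; have [p [p1 dp]] := fractal k.
  exists (g ^ p); first exact: normalJ.
  by rewrite -(conj1g p1); apply: decompJ.
Qed.

Lemma left_rist_mem N g g0 g1 : is_normal_subgroup N ->
  left_rist N g0 -> left_rist N g1 -> decomp g g0 g1 -> N g.
Proof.
move=> nN [p Np dp] [q Nq dq] dg.
have dpq : decomp (p * q ^ ta) g0 g1.
  by rewrite -[g0]mulg1 -[g1]mul1g; apply: decompM dp (decompJa dq).
by rewrite (decomp_inj dg dpq); apply: normalM => //; apply: normalJ.
Qed.

(** An element is determined modulo [N] by whether it swaps the two subtrees and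
    by the classes of its two sections modulo [left_rist N]. *)
Lemma left_rist_finite_index N : is_normal_subgroup N ->
  finite_index (left_rist N) -> finite_index N.
Proof.
move=> nN [T [f fP]].
have /choice[s sP] : forall g, exists t : bool * Gtilde * Gtilde,
    decomp (ta ^+ t.1.1 * g) t.1.2 t.2.
  by move=> g; have [e [g0 [g1 dg]]] := decomp_exists g; exists (e, g0, g1).
exists (bool * T * T)%type, (fun g => ((s g).1.1, f (s g).1.2, f (s g).2)).
move=> g h [ee /fP e0 /fP e1]; apply: (left_rist_mem nN e0 e1).
have -> : g^-1 * h = (ta ^+ (s g).1.1 * g)^-1 * (ta ^+ (s h).1.1 * h).
  by rewrite ee invgM -mulgA mulKg.
exact: decompM (decompV (sP g)) (sP h).
Qed.

(** * The branching subgroup *)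

Definition kx := [~ ta, tb].
Definition ky := [~ ta, td].

Definition K : set Gtilde :=
  [set g | forall N, is_normal_subgroup N -> N kx -> N ky -> N g].

Lemma K_normal : is_normal_subgroup K.
Proof.
split; first split.
- by rewrite inE => N nN _ _; apply: normal1.
- move=> g h; rewrite !inE => Kg Kh N nN Nx Ny.
  by apply: normal_div => //; [apply: Kg | apply: Kh].
- by move=> g h Kg N nN Nx Ny; apply: normalJ => //; apply: Kg.
Qed.

Lemma Kx : K kx. Proof. by []. Qed.

Lemma Ky : K ky. Proof. by []. Qed.

Lemma bcd_fun_comm w : [/\ b_fun (c_fun w) = c_fun (b_fun w),
  b_fun (d_fun w) = d_fun (b_fun w) & c_fun (d_fun w) = d_fun (c_fun w)].
Proof. by elim: w => [|[] s [bc bd cd]] //=; rewrite ?bc ?bd ?cd //; case: s {bc bd cd}. Qed.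

Lemma tbc : commute tb tc.
Proof. by apply: act_ext => w; case: (bcd_fun_comm w). Qed.

Lemma tbd : commute tb td.
Proof. by apply: act_ext => w; case: (bcd_fun_comm w). Qed.

Lemma tcd : commute tc td.
Proof. by apply: act_ext => w; case: (bcd_fun_comm w). Qed.

(** By normality of [left_rist K] it suffices to reach the two generators of [K].
    Since [b = (a, c)] and [d ^ a = (b, 1)], [c ^ a = (d, 1)], they come from
    the commutators of [b] with [d ^ a] and [c ^ a], which lie in [K]. *)
Lemma branch k : K k -> exists2 g, K g & decomp g k 1.
Proof.
have K_tbJ t : commute tb t -> K [~ tb, t ^ ta].
  move=> bt; rewrite conjgE taV -invgR; apply: (normalV K_normal).
  have ba : commod K tb ta by apply/commodP; exact: Kx.
  have nK := K_normal; apply/commodP; apply: (commodM nK ba).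
  by apply: (commodM nK _ ba); exact: commute_commod.
move=> /(_ (left_rist K)); apply; first exact/left_rist_normal/K_normal.
- exists [~ tb, td ^ ta]; first exact: K_tbJ tbd.
  by rewrite -(commg1 tc); apply: decompR decomp_b (decompJa decomp_d).
- exists [~ tb, tc ^ ta]; first exact: K_tbJ tbc.
  by rewrite -(commg1 tc); apply: decompR decomp_b (decompJa decomp_c).
Qed.

Lemma kx_def : kx = ta * (tb * (ta * tb)).
Proof. by rewrite /kx commgEl conjgE taV tbV. Qed.

Lemma ky_def : ky = ta * (td * (ta * td)).
Proof. by rewrite /ky commgEl conjgE taV tdV. Qed.

(** Indeed [ky = (b, b)]. *)
Lemma ky2 : ky * ky = 1.
Proof.
rewrite ky_def; apply: act_ext => -[|[] s] //=;
  by rewrite !actM /act /= ?b_funK.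
Qed.

(** The two elements are [(1, d)] and [(d, 1)]. *)
Lemma tcJ : commute tc (tc ^ ta).
Proof. by rewrite /commute conjgE taV; apply: act_ext => -[|[] s]. Qed.

(** The image of [K] in the quotient is centralised by [b] and [c * a], and the
    action of [a] on it turns out to be trivial. Hence [a], [b], [c] centralise
    the images of [kx], [kx ^ d], [ky], while [d] exchanges the first two; this
    is what the normal form requires. *)
Lemma central_mod_finite_index N : is_normal_subgroup N ->
  (forall k, K k -> N [~ k, tb] /\ N [~ k, tc * ta]) -> finite_index N.
Proof.
move=> nN NK.
have eqE g h : g = h -> eqmod N g h by move=> ->; apply: eqmod_refl.
have tbK k : K k -> commod N tb k by move=> /NK[Nkb _]; apply/commodP.
have tcaK k : K k -> commod N (tc * ta) k by move=> /NK[_ ?]; apply/commodP.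
pose kx' := kx ^ td.
have Kx' : K kx' by apply: (normalJ K_normal) Kx.
have x'E : kx' = td * (kx * td) by rewrite /kx' conjgE tdV.
have sym := commod_sym nN; have mul := commodM nN.
have com g h : commute g h -> commod N g h := @commute_commod _ _ nN g h.
have eqvN := eqmod_equiv nN; have properN := eqmod_proper nN.
have cK k : K k -> commod N ta k -> commod N tc k.
  (* [c] is the product of [c * a] and the involution [a]. *)
  move=> /tcaK/sym kca /sym ka; rewrite -[tc]mulg1 -taa mulgA.
  by apply/sym; apply/mul.
have bxV : tb * kx = kx^-1 * tb.
  by rewrite invgR /kx !commgEl !conjgE taV tbV -!mulgA.
have axV : ta * kx = kx^-1 * ta.
  by rewrite invgR /kx !commgEl !conjgE taV tbV !mulgA taa mul1g -!mulgA taa mulg1.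
have xx : eqmod N (kx * kx) 1 by apply: inverted_square nN _ _ bxV _; apply: tbK Kx.
have ax : commod N ta kx.
  by rewrite /commod axV -[kx^-1]mulg1 -xx mulKg; reflexivity.
have kyV : ky^-1 = ky := mulg1_eq ky2.
have ay : commute ta ky.
  by rewrite /commute -[in RHS]kyV invgR /ky !commgEl !conjgE taV tdV !mulgA taa mul1g -!mulgA taa mulg1.
have dy : commute td ky.
  by rewrite /commute -[in RHS]kyV invgR /ky !commgEl !conjgE taV tdV -!mulgA.
have xy : commod N kx ky.
  by apply/sym; rewrite kx_def; do !apply/mul; apply/sym;
    [apply: com | apply: tbK | apply: com | apply: tbK].
have ab : ta * tb = kx * (tb * ta) by rewrite kx_def -!mulgA [tb * (tb * _)]mulgA tbb mul1g taa mulg1.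
have ad : ta * td = ky * (td * ta) by rewrite ky_def -!mulgA [td * (td * _)]mulgA tdd mul1g taa mulg1.
have ax' : commod N ta kx' by rewrite x'E; apply: (commod_twist nN ky2 dy ad).
have x'x : commod N kx' kx.
  by rewrite kx_def; do !apply/mul; apply/sym => //; apply: tbK.
have yx' : commod N ky kx'.
  rewrite x'E; apply/mul; first exact/com/commute_sym.
  by apply/mul; [apply/sym | exact/com/commute_sym].
apply: (@nform_finite_index _ N nN ta tb tc td kx kx' ky (tc ^ ta)) => //.
all: try by apply: eqE; rewrite ?taa ?tbb ?tcc ?tdd ?ky2.
- exact: tbK Kx.
- exact: tbK Kx'.
- exact: tbK Ky.
- exact: cK Kx ax.
- exact: cK Kx' ax'.
- exact: cK Ky (com _ _ ay).
- by apply: eqE; rewrite conjgCV tdV.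
- by apply: eqE; rewrite -conjgC.
- exact: sym x'x.
- exact: sym yx'.
- exact: com tbd.
- exact/com/commute_sym/tbc.
- exact: com tcd.
- exact: com tcJ.
- by apply: eqE; rewrite conjgCV taV.
- by apply: eqE; rewrite -conjgC.
- exact: Gtilde_ind.
Qed.

(** Commuting [(k, 1)] in [K] with [kx = (c a, a c)] and [ky = (b, b)] leaves the
    commutators of [k] with [c a] and [b] on the left. *)
Lemma derived_finite_index N : is_normal_subgroup N ->
  (forall k l, K k -> K l -> N [~ k, l]) -> finite_index N.
Proof.
move=> nN NK; apply: (left_rist_finite_index nN).
apply: (central_mod_finite_index (left_rist_normal nN)) => k /branch[p Kp dp].
have dx : decomp kx (tc * ta) (ta * tc).
  have -> : kx = tb ^ ta * tb by rewrite /kx commgEr tbV.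
  exact: decompM (decompJa decomp_b) decomp_b.
have dy : decomp ky tb tb.
  have -> : ky = td ^ ta * td by rewrite /ky commgEr tdV.
  rewrite -[X in decomp _ X _]mulg1 -[X in decomp _ _ X]mul1g.
  exact: decompM (decompJa decomp_d) decomp_d.
split.
- exists [~ p, ky]; first exact: NK.
  by rewrite -(comm1g tb); apply: decompR.
- exists [~ p, kx]; first exact: NK.
  by rewrite -(comm1g (ta * tc)); apply: decompR.
Qed.

(** * Elements supported below a vertex *)

Fixpoint graft (f : word -> word) (u w : word) : word :=
  match u, w with
  | [::], _ => f w
  | x :: u', y :: w' => if x == y then y :: graft f u' w' else w
  | _ :: _, [::] => [::]
  end.

Lemma graft_cat f u s : graft f u (u ++ s) = u ++ f s.
Proof. by elim: u => //= x u ->; rewrite eqxx. Qed.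

Lemma graft_out f u w : ~~ prefix u w -> graft f u w = w.
Proof.
elim: u w => [|x u IH] [|y w] //=.
by case: eqP => //= _ /IH ->.
Qed.

Lemma graft_exists u k : K k -> exists2 g, K g & act g =1 graft (act k) u.
Proof.
move=> Kk; elim: u => [|x u [h /branch[g Kg dg] hu]]; first by exists k.
case: x; [exists (g ^ ta) | exists g] => //.
- exact: (normalJ K_normal).
- move=> [|[] s]; rewrite ?act_nil //=.
  + by rewrite (decompJa dg s).2 hu.
  + by rewrite (decompJa dg s).1.
- move=> [|[] s]; rewrite ?act_nil //=.
  + by rewrite (dg s).2.
  + by rewrite (dg s).1 hu.
Qed.

(** Each letter of [u] costs one passage to [left_rist]; when the letter is 1, the
    grafted element is first moved to the left subtree by conjugation by [a]. *)
Lemma grafted_finite_index u N : is_normal_subgroup N ->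
  (forall k l g, K k -> K l -> act g =1 graft (act [~ k, l]) u -> N g) ->
  finite_index N.
Proof.
elim: u N => [|x u IH] N nN NK.
  by apply: derived_finite_index => // k l Kk Kl; apply: NK Kk Kl _.
apply: (left_rist_finite_index nN); apply: IH (left_rist_normal nN) _ => k l g Kk Kl gE.
have Kkl : K [~ k, l] by apply: (normalRl K_normal).
have [h Kh hE] := graft_exists u Kkl.
have hg : h = g by apply: act_ext => w; rewrite hE gE.
rewrite hg in Kh; have [p _ dp] := branch Kh; exists p => //.
case: x NK => NK.
- rewrite -[p]conjg1 -taa conjgM; apply: (normalJ nN).
  apply: NK Kk Kl _ => -[|[] s]; rewrite ?act_nil //=.
  + by rewrite (decompJa dp s).2 gE.
  + by rewrite (decompJa dp s).1.
- apply: NK Kk Kl _ => -[|[] s]; rewrite ?act_nil //=.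
  + by rewrite (dp s).2.
  + by rewrite (dp s).1 gE.
Qed.

Lemma act_cat g u : size (act g u) = size u /\
  exists h, forall s, act g (u ++ s) = act g u ++ act h s.
Proof.
elim: u g => [|x u IH] g; first by rewrite act_nil; split=> //; exists g.
have [e [g0 [g1 dg]]] := decomp_exists g.
have gE s : act g (x :: s) = (e (+) x) :: act (if x then g1 else g0) s.
  apply: (can_inj (actK (ta ^+ e))); rewrite -actM.
  rewrite (_ : act _ _ = x :: act (if x then g1 else g0) s); last first.
    by case: x; [rewrite (dg s).2 | rewrite (dg s).1].
  by case: (e); case: (x).
rewrite /= !gE /=; have [-> [h hE]] := IH (if x then g1 else g0).
by split=> //; exists h => s; rewrite gE hE.
Qed.

Lemma graftM g h k l u : act g =1 graft (act k) u -> act h =1 graft (act l) u ->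
  act (g * h) =1 graft (act (k * l)) u.
Proof.
move=> gE hE w; rewrite actM hE gE {gE hE}.
elim: u w => [|x u IH] [|y w] //=.
by case: (eqVneq x y) => [<-|/negPf /= ->]; rewrite ?eqxx ?IH.
Qed.

Lemma graftV g k u : act g =1 graft (act k) u -> act g^-1 =1 graft (act k^-1) u.
Proof.
move=> gE w; apply: (can_inj (actK g)); rewrite actVK gE.
elim: u w {gE} => [w|x u IH [|y w]] //=; first by rewrite actVK.
by case: (eqVneq x y) => [<-|/negPf /= ->]; rewrite ?eqxx -?IH.
Qed.

Lemma graftR g h k l u : act g =1 graft (act k) u -> act h =1 graft (act l) u ->
  act [~ g, h] =1 graft (act [~ k, l]) u.
Proof.
by move=> gE hE; rewrite !commgEl !conjgE; apply: graftM (graftV gE) _;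
  apply: graftM (graftV hE) (graftM gE hE).
Qed.

(** [p ^ g] acts only below the preimage of [u] under [g], a vertex of the level
    of [u] that differs from [u]. *)
Lemma conj_graft_fixes g u p f s : act g u <> u -> act p =1 graft f u ->
  act (p ^ g) (u ++ s) = u ++ s.
Proof.
move=> gu pE; rewrite conjgE !actM pE graft_out ?actK //.
have [sz [h ->]] := act_cat g u.
rewrite prefixE take_size_cat //; exact/eqP/gu.
Qed.

Lemma conj_graft_commute g u p q f f' : act g u <> u ->
  act p =1 graft f u -> act q =1 graft f' u -> commute (p ^ g) q.
Proof.
move=> gu pE qE; apply: act_ext => w; rewrite [LHS]actM [RHS]actM !qE.
have [/prefixP[s ->]|uw] := boolP (prefix u w).
  by rewrite graft_cat !(conj_graft_fixes _ gu pE) graft_cat.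
rewrite !graft_out //; apply: contra uw => /prefixP[s ws].
apply/prefixP; exists s; apply: (can_inj (actK (p ^ g))).
by rewrite ws (conj_graft_fixes _ gu pE).
Qed.

Lemma commMg_commute (G : groupType) (g h k : G) :
  commute h k -> [~ g * h, k] = [~ g, k] ^ h.
Proof. by move=> hk; rewrite !commgEl !conjgE invgM -!mulgA hk. Qed.

(** For [p], [q] grafted below [u], the double commutator of [p^-1] with [g] and
    [q] lies in [N] and is a conjugate of [[p, q]]. *)
Lemma moved_finite_index N g u : is_normal_subgroup N -> N g -> act g u <> u ->
  finite_index N.
Proof.
move=> nN Ng gu; apply: (grafted_finite_index (u := u) nN) => k l h Kk Kl hE.
have [p _ pE] := graft_exists u Kk.
have [q _ qE] := graft_exists u Kl.
have -> : h = [~ p, q].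
  by apply: act_ext => w; rewrite hE (graftR pE qE).
set r := p^-1 ^ g.
have rq : commute r q := conj_graft_commute gu (graftV pE) qE.
have rpq : [~ [~ p^-1, g], q] = [~ p, q] ^ r.
  by rewrite [[~ p^-1, g]]commgEl invgK commMg_commute.
rewrite -[[~ p, q]](conjgK r) -rpq.
by apply/(normalJ nN)/(normalRl nN)/(normalRr nN).
Qed.

(** * Infiniteness and the main result *)

Lemma Gtilde_infinite : infinite_set [set: Gtilde].
Proof.
have /choice[f fP] : forall h, exists g, exists g1, decomp g h g1 by exact: fractal.
have f_inj : injective f.
  move=> h k fhk; have [[g dh] [g' dk]] := (fP h, fP k).
  by rewrite fhk in dh; have [] := decomp_unique dh dk.
have fa h : f h <> ta.
  by move=> fh; have [g1 /(_ [::])[]] := fP h; rewrite fh.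
move=> /(@finite_preimage nat _ _ (fun n => iter n f ta)) fin.
apply: infinite_nat; apply: fin => m n _ _; elim: m n => [|m IH] [|n] //=.
- by move=> /esym /fa.
- by move=> /fa.
- by move=> /f_inj /IH ->.
Qed.

Theorem proposition5p5 : just_infinite Gtilde.
Proof.
split=> [|N nN N1]; first exact: Gtilde_infinite.
apply: (finite_left_cosets nN).
have [[g Ng g1]|trivN] := pselect (exists2 g, N g & g <> 1).
  have [[u gu]|fixg] := pselect (exists u, act g u <> u).
    exact: moved_finite_index nN Ng gu.
  case: g1; apply: act_ext => u; apply: contrapT => gu.
  by apply: fixg; exists u.
case: N1; apply/seteqP; split=> [g Ng|_ ->]; last exact: normal1.
by apply: contrapT => g1; apply: trivN; exists g.
Qed.
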